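(* Let $d \ge 0$ be an integer and let $f \colon \Delta_d \to S(d+1)$ be continuous, with entries $f_{ij}$. Then there is an $x \in \Delta_d$ and a permutation $\pi$ of $[d+1]$ such that $f_{i\pi(i)}(x) \le x_{\pi(i)}$ for all $i \in [d+1]$.
   Context: $[n] = \{1,\dots,n\}$. $\Delta_d = \{x \in \mathbb{R}^{d+1} : \sum_i x_i = 1,\ x_i \ge 0 \text{ for all } i \in [d+1]\}$. $S(m) \subseteq \mathbb{R}^{m \times m}$ denotes the set of stochastic matrices: all entries are non-negative and every row sums to one. $f_{ij}(x)$ denotes the entry of $f(x)$ in row $i$ and column $j$. *)

(* Defs.v *)
From mathcomp Require Import all_boot all_order all_algebra all_fingroup.
From mathcomp Require Import all_classical all_reals all_analysis.

Set Implicit Arguments.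
Unset Strict Implicit.
Unset Printing Implicit Defensive.

Import Order.TTheory GRing.Theory Num.Theory.
Import numFieldNormedType.Exports.

Local Open Scope classical_set_scope.
Local Open Scope ring_scope.

Definition simplex (R : realType) (d : nat) : set 'rV[R]_d.+1 :=
  [set x | \sum_i x ord0 i = 1 /\ forall i, 0 <= x ord0 i].

Definition stochastic (R : realType) (m : nat) : set 'M[R]_m :=
  [set A | (forall i j, 0 <= A i j) /\ forall i, \sum_j A i j = 1].

Arguments simplex : clear implicits.
Arguments stochastic : clear implicits.

(* Main.v *)
Require Import Defs.
From mathcomp Require Import all_boot zify.

(** Fix e in (0, 1) and put g_ij(x) = max(0, x_j - (1 - e) f_ij(x)).  Each row of
    this matrix has a positive sum, so its rows can be normalised continuously
    to sum 1.  If at some x all column sums of the normalised matrix are at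
    most 1, then Hall's theorem yields a permutation along which its entries
    are positive (positive_entries_perm), which means that
    (1 - e) f_{i pi(i)}(x) < x_{pi(i)} for all i.  Letting e tend to 0 in the
    compact simplex gives the theorem, there being finitely many permutations.

    To find x, let A_j be the closed set of points whose j-th column sum is at
    most 1.  These sets cover the simplex, since the column sums average 1.  By
    closed_cover_simplex, some x lies in A_j whenever x_j > 0; and if x_j = 0,
    the j-th column of g vanishes at x, so that its sum is at most 1 as well.

    The covering theorem is of the strength of Brouwer's theorem.  It comes from
    Scarf's combinatorial lemma (scarf), which replaces triangulations by
    total orders: the rooms, sets of grid points that are dominant for the
    coordinate orders, meet along doors like the cells of a triangulation along
    their facets, so Sperner's parity argument finds a room whose colours are
    those of the face that it lies near.  Scarf's lemma imposes no boundary
    condition on the colouring. *)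

Set Implicit Arguments.
Unset Strict Implicit.
Unset Printing Implicit Defensive.

(** * Counting doors and rooms *)

(** The fibres of f over its image are singletons, save one which has two
    elements; exactly these two can be deleted without shrinking the image.
    The lemma is used twice, for the two incidence counts of a parity
    argument: with f a colouring and with f a selection of minima. *)
Lemma card_redundant (A B : finType) (f : A -> B) (X : {set A}) :
  #|X| = #|f @: X|.+1 -> #|[set a in X | f @: (X :\ a) == f @: X]| = 2.
Proof.
move=> cX.
have [a aX [b bX [ab fab]]] : exists2 a, a \in X & exists2 b, b \in X & a != b /\ f a = f b.
  have : ~~ [forall a in X, forall b in X, (f a == f b) ==> (a == b)].
    apply/negP => /forall_inP h; move: cX; rewrite card_in_imset; first lia.
    by move=> a b aX bX fab; apply/eqP; have /forall_inP/(_ _ bX)/implyP := h _ aX; apply; apply/eqP.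
  rewrite negb_forall_in => /exists_inP[a aX]; rewrite negb_forall_in => /exists_inP[b bX].
  by rewrite negb_imply => /andP[/eqP fab ab]; exists a => //; exists b.
have imD x y : x \in X -> y \in X -> x != y -> f x = f y -> f @: (X :\ x) = f @: X.
  move=> xX yX xy fxy; apply/eqP; rewrite eqEsubset imsetS ?subsetDl //=.
  apply/subsetP => _ /imsetP[z zX ->]; have [->|zx] := eqVneq z x.
    by rewrite fxy imset_f // !inE eq_sym xy.
  by rewrite imset_f // !inE zx.
have injD : {in X :\ a &, injective f}.
  apply/imset_injP/eqP; rewrite (imD a b) //.
  by move: cX; rewrite (cardsD1 a X) aX; lia.
suff -> : [set x in X | f @: (X :\ x) == f @: X] = [set a; b] by rewrite cards2 ab.
apply/setP => x; rewrite !inE; apply/andP/orP => [[xX /eqP fx]|[]/eqP->]; last 2 first.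
- by rewrite aX (imD a b).
- by rewrite bX (imD b a) // eq_sym.
have [|xa] := eqVneq x a; first by left.
right; have : f x \in f @: (X :\ x) by rewrite fx imset_f.
case/imsetP => y; rewrite !inE => /andP[yx yX] fxy.
have [ya|ya] := eqVneq y a.
  apply/eqP/injD; rewrite ?inE ?xa ?xX ?bX ?andbT //; first by rewrite eq_sym.
  by rewrite fxy ya.
by case/eqP: yx; apply: injD; rewrite ?inE ?xa ?ya.
Qed.

Section Dominance.
Variables (V I : finType) (r : I -> V -> nat).

(** Each index i orders V by the rank r i.  In a simplex, with r i ranking
    points by their i-th coordinate, a dominant set of points is one whose
    coordinatewise minima leave no room for a further point above all of
    them. *)
Definition dominant (s : {set V}) :=
  [forall t, exists i, forall v in s, r i t <= r i v].

Lemma dominantP (s : {set V}) :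
  reflect (forall t, exists i, {in s, forall v, r i t <= r i v}) (dominant s).
Proof.
apply: (iffP forallP) => h t; last first.
  by have [i hi] := h t; apply/existsP; exists i; apply/forall_inP.
by have /existsP[i /forall_inP hi] := h t; exists i.
Qed.

Lemma dominantS (s s' : {set V}) : s \subset s' -> dominant s' -> dominant s.
Proof.
move=> /subsetP ss /dominantP h; apply/dominantP => t; have [i hi] := h t.
by exists i => v /ss /hi.
Qed.

(** A door s (a dominant set one element short of the number of indices) lies
    in exactly two rooms (dominant sets with as many elements as indices).  By
    dominance every element of s is the minimum of s for some index, so two
    indices share their minimum and the others do not.  If t extends s, it
    must take over the minimum from one of those two indices i, and dominance
    forces t to be the i-largest among the points lying above the minima of
    all other indices.  The last hypothesis says that such points exist. *)
Lemma card_extensions (s : {set V}) (v0 : V) :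
  (forall i, injective (r i)) -> v0 \in s -> dominant s -> #|s|.+1 = #|I| ->
  (forall i, exists t, forall l, l != i -> exists2 v, v \in s & r l v < r l t) ->
  #|[set t | (t \notin s) && dominant (t |: s)]| = 2.
Proof.
move=> rinj v0s /[dup] doms /dominantP dom cs ext.
pose mu i := [arg min_(v < v0 in s) r i v].
have mus i : mu i \in s by rewrite /mu; case: arg_minnP.
have mumin i : {in s, forall v, r i (mu i) <= r i v} by rewrite /mu; case: arg_minnP.
have mu_onto v : v \in s -> exists i, mu i = v.
  move=> vs; have [i hi] := dom v; exists i.
  by apply: (rinj i); apply/eqP; rewrite eqn_leq mumin // hi.
have imu : mu @: setT = s.
  apply/setP => v; apply/imsetP/idP => [[i _ ->] //|/mu_onto[i <-]]; by exists i.
(* P consists of the two indices that share their minimum. *)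
have := @card_redundant _ _ mu setT; rewrite imu cardsT => /(_ (esym cs)).
set P := (X in #|X|) => cP.
have PP i : reflect (forall v, v \in s -> exists2 l, l != i & mu l = v) (i \in P).
  rewrite !inE /=; apply: (iffP eqP) => [h v|h].
    by rewrite -h => /imsetP[l]; rewrite !inE => /andP[li _] ->; exists l.
  apply/setP => v; apply/imsetP/idP => [[l _ ->] //|/h[l li <-]].
  by exists l; rewrite ?inE ?li.
(* M i is the set of points that only the index i can dominate. *)
pose M i : pred V := fun t => [forall l, (l != i) ==> (r l (mu l) < r l t)].
have MP i t : reflect (forall l, l != i -> r l (mu l) < r l t) (M i t).
  by apply: (iffP forallP) => h l; [move/(implyP (h l))|apply/implyP/h].
have Mex i : {t | M i t}.
  apply: sigW; have [t ht] := ext i; exists t; apply/MP => l /ht[v vs].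
  by apply: leq_ltn_trans; apply: mumin.
pose x i := [arg max_(t > sval (Mex i) | M i t) r i t].
have xM i : M i (x i) by rewrite /x; case: arg_maxnP => //; apply: (svalP (Mex i)).
have xmax i t : M i t -> r i t <= r i (x i).
  by rewrite /x; case: arg_maxnP => [|y _ h]; [apply: (svalP (Mex i))|apply: h].
have xle i : r i (x i) <= r i (mu i).
  have [l hl] := dom (x i); have [li|li] := eqVneq l i; first by move: hl; rewrite li; apply.
  by have /MP/(_ l li) := xM i; rewrite ltnNge hl.
have xinj : injective x.
  move=> i j xij; apply/eqP/negP => /negP ij.
  by have /MP/(_ j) := xM i; rewrite eq_sym ij xij => /(_ isT); rewrite ltnNge xle.
suff -> : [set t | (t \notin s) && dominant (t |: s)] = x @: P.
  by rewrite card_imset.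
apply/setP => t; rewrite inE; apply/andP/imsetP => [[ts /dominantP dt]|[i /PP iP ->]].
  have [i hi] := dt t.
  have rti : r i t < r i (mu i).
    rewrite ltn_neqAle hi ?inE ?mus ?orbT // andbT.
    by apply: contraNneq ts => /rinj ->.
  pose L := [set l | r l (mu l) < r l t].
  have muL : s \subset mu @: L.
    apply/subsetP => v vs; have [l hl] := dt v; apply/imsetP.
    have mul : mu l = v.
      apply: (rinj l); apply/eqP; rewrite eqn_leq mumin // hl //.
      by rewrite inE mus orbT.
    exists l => //; rewrite inE mul ltn_neqAle hl ?setU11 // andbT.
    by apply: contraNneq ts => /rinj <-.
  (* L contains at least #|s| indices, all of them different from i. *)
  have Li : L = [set~ i].
    apply/eqP; rewrite eqEcard cardsC1 -cs /=.
    rewrite (leq_trans (subset_leq_card muL)) ?leq_imset_card // andbT.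
    apply/subsetP => l; rewrite !inE; apply: contraTneq => ->.
    by rewrite -leqNgt ltnW.
  have Mt : M i t by apply/MP => l li; have : l \in L; [rewrite Li !inE|rewrite inE].
  exists i.
    by apply/PP => v /(subsetP muL)/imsetP[l]; rewrite Li !inE => li ->; exists l.
  apply: (rinj i); apply/eqP; rewrite eqn_leq xmax //=.
  have [l hl] := dt (x i).
  have [li|li] := eqVneq l i; first by move: hl; rewrite li; apply; rewrite setU11.
  by have /MP/(_ l li) := xM i; rewrite ltnNge hl // inE mus orbT.
split.
  apply/negP => xs; have [l li ml] := iP _ xs; have /MP/(_ l li) := xM i.
  by rewrite ml ltnn.
apply/dominantP => u; have [Mu|nMu] := boolP (M i u).
  exists i => v; rewrite !inE => /orP[/eqP->|vs]; first exact: xmax.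
  by rewrite (leq_trans (xmax _ _ Mu)) // (leq_trans (xle i)) // mumin.
move: nMu; rewrite negb_forall => /existsP[l]; rewrite negb_imply -leqNgt.
case/andP => li ul; exists l => v; rewrite !inE => /orP[/eqP->|vs].
  by have /MP/(_ l li)/ltnW := xM i; apply: leq_trans.
by rewrite (leq_trans ul) // mumin.
Qed.

(** The local count in Sperner's argument: in a set that carries every colour
    once, only the element of colour i0 can be deleted so as to leave all the
    other colours; if exactly i0 is missing, one colour is repeated and either
    element of that colour can be deleted; otherwise no deletion works. *)
Lemma odd_facets (c : V -> I) (i0 : I) (s : {set V}) : #|s| = #|I| ->
  odd #|[set d in s | c @: (s :\ d) == [set~ i0]]| = (c @: s == setT).
Proof.
move=> cs; have [cT|ncT] := eqVneq.
  have cinj : {in s &, injective c} by apply/imset_injP; rewrite cT cardsT cs.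
  have /imsetP[d ds ci0] : i0 \in c @: s by rewrite cT.
  suff -> : [set d in s | c @: (s :\ d) == [set~ i0]] = [set d] by rewrite cards1.
  have cD e : e \in s -> c @: (s :\ e) = [set~ c e].
    move=> es; apply/setP => i; rewrite !inE; apply/imsetP/idP.
      case=> z; rewrite !inE => /andP[ze zs] ->.
      by apply: contraNneq ze => /cinj->.
    have /imsetP[z zs ->] : i \in c @: s by rewrite cT.
    by move=> ne; exists z; rewrite ?inE ?zs ?andbT //; apply: contraNneq ne => ->.
  apply/setP => e; rewrite !inE; apply/andP/eqP => [[es /eqP]|->].
    rewrite cD // => /setP/(_ (c e)); rewrite !inE eqxx ci0 => /esym/negbFE/eqP.
    exact: cinj.
  by rewrite ds cD // ci0.
have [ci0|nci0] := eqVneq (c @: s) [set~ i0].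
  rewrite -ci0 card_redundant // ci0 cardsC1 cs prednK //.
  by apply/card_gt0P; exists i0.
suff -> : [set d in s | c @: (s :\ d) == [set~ i0]] = set0 by rewrite cards0.
apply/setP => d; rewrite !inE; apply/negP => /andP[ds /eqP cd].
have cs' : c @: s = c d |: [set~ i0] by rewrite -cd -imsetU1 setD1K.
have [cdi|cdi] := eqVneq (c d) i0.
  by case/eqP: ncT; rewrite cs' cdi setUCr.
by case/eqP: nci0; rewrite cs'; apply/setUidPr; rewrite sub1set !inE.
Qed.

End Dominance.

(** * Scarf's lemma *)

Section Scarf.
Variables (T I : finType) (r : I -> T -> nat) (c : T -> I).
Hypothesis rinj : forall i, injective (r i).

(** Besides the points of T there is one slack element for each index: the
    slack element of i is the smallest for i, and larger than all points for
    every other index.  A slack element in a set removes its index from the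
    indices that can dominate points, so that a set of points together with
    an unrelated set of indices becomes a single subset of T + I. *)
Definition slack_rank (i : I) (v : T + I) : nat :=
  match v with
  | inl t => (r i t).+1
  | inr j => if j == i then 0 else (\max_t r i t + enum_rank j).+2
  end.

Definition slack_color (v : T + I) : I :=
  match v with inl t => c t | inr i => i end.

Local Notation dom := (dominant slack_rank).

Lemma slack_rank_inj i : injective (slack_rank i).
Proof.
have lt_max t (j : I) : r i t < (\max_t r i t + enum_rank j).+1.
  by rewrite ltnS (leq_trans (leq_bigmax t)) ?leq_addr.
move=> [t|j] [t'|j'] //=.
- by case=> /rinj ->.
- by case: ifP => // _ [E]; have := lt_max t j'; rewrite -E ltnn.
- by case: ifP => // _ [E]; have := lt_max t' j; rewrite E ltnn.
- case: eqP => [->|_]; case: eqP => [->|_] //.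
  by case=> /addnI/val_inj/enum_rank_inj ->.
Qed.

Lemma slack_rank_lt i j t : i != j -> slack_rank i (inl t) < slack_rank i (inr j).
Proof.
by move=> ij /=; rewrite eq_sym (negPf ij) !ltnS (leq_trans (leq_bigmax t)) ?leq_addr.
Qed.

Lemma card_extensions_inner (s : {set T + I}) (t : T) :
  inl t \in s -> #|s|.+1 = #|I| -> dom s ->
  #|[set v | (v \notin s) && dom (v |: s)]| = 2.
Proof.
move=> ts cs doms; apply: (card_extensions slack_rank_inj ts) => // i.
by exists (inr i) => l li; exists (inl t); last exact: slack_rank_lt.
Qed.

(** The exception to the count of two: a door made of slack elements only plays
    the part of a facet on the boundary of a triangulation.  Its only room
    arises by adding the i0-largest point, as the set of all slack elements
    dominates no point. *)
Lemma card_extensions_outer (t0 : T) (i0 : I) :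
  #|[set v | (v \notin inr @: [set~ i0]) && dom (v |: inr @: [set~ i0])]| = 1.
Proof.
pose m := [arg max_(t > t0) r i0 t].
have mmax t : r i0 t <= r i0 m by rewrite /m; case: arg_maxnP => // ? _; apply.
have notl t : (inl t : T + I) \notin inr @: [set~ i0].
  by apply/imsetP => -[].
suff -> : [set v | (v \notin inr @: [set~ i0]) && dom (v |: inr @: [set~ i0])]
    = [set inl m] by rewrite cards1.
apply/setP => v; rewrite !inE; apply/andP/eqP => [[vs /dominantP dv]|->].
  have key t : {in v |: inr @: [set~ i0], forall w,
      slack_rank i0 (inl t) <= slack_rank i0 w}.
    have [i hi] := dv (inl t); suff ii0 : i = i0 by move: hi; rewrite ii0.
    apply/eqP/negPn/negP => ii0; have /hi : inr i \in v |: inr @: [set~ i0].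
      by rewrite in_setU imset_f ?orbT // !inE.
    by rewrite /= eqxx.
  case: v vs dv key => [t _ _ key|j]; last first.
    rewrite mem_imset ?inE ?negbK; last by move=> ? ? [].
    move=> /eqP -> _ /(_ t0 (inr i0)); rewrite setU11 /= eqxx => /(_ isT).
    by [].
  congr inl; apply: (rinj (i := i0)); apply/eqP; rewrite eqn_leq mmax.
  by have := key m (inl t); rewrite setU11 /= ltnS; apply.
rewrite notl; split=> //; apply/dominantP => -[t|j]; last first.
  by exists j => w _ /=; rewrite eqxx.
exists i0 => w; rewrite !inE => /orP[/eqP->|/imsetP[j]]; first by rewrite /= ltnS.
by rewrite !inE => ji0 ->; rewrite ltnW // slack_rank_lt // eq_sym.
Qed.

(** Count the pairs of a room and a facet of it with all colours but i0.
    Room by room the parity is the number of rooms with all colours; door by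
    door each door contributes two, except for the outer one. *)
Lemma odd_colorful_rooms (t0 : T) (i0 : I) :
  odd #|[set s : {set T + I} | [&& dom s, #|s| == #|I| & slack_color @: s == setT]]|.
Proof.
pose room (s : {set T + I}) := dom s && (#|s| == #|I|).
pose good (s : {set T + I}) := slack_color @: s == [set~ i0].
have -> : odd #|[set s | [&& dom s, #|s| == #|I| & slack_color @: s == setT]]|
    = odd (\sum_(s | room s) #|[set d in s | good (s :\ d)]|).
  rewrite -sum1_card big_mkcond [X in _ = odd X]big_mkcond /=.
  apply: (big_ind2 (fun a b => odd a = odd b)) => // [a b a' b' E E'|s _].
    by rewrite !oddD E E'.
  rewrite inE andbA -/(room s); case: (boolP (room s)) => [/andP[_ /eqP cs]|_] //=.
  by rewrite odd_facets //; case: (_ == setT).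
have -> : \sum_(s | room s) #|[set d in s | good (s :\ d)]| =
    \sum_(s | good s) #|[set v | (v \notin s) && room (v |: s)]|.
  transitivity (\sum_s \sum_(d | [&& room s, d \in s & good (s :\ d)]) 1).
    rewrite big_mkcond; apply: eq_bigr => s _; case: (room s) => /=.
      by rewrite sum1_card; apply: eq_card => d; rewrite !inE.
    by rewrite big_pred0.
  transitivity (\sum_s \sum_(d | [&& good s, d \notin s & room (d |: s)]) 1); last first.
    rewrite [in RHS]big_mkcond; apply: eq_bigr => s _; case: (good s) => /=.
      by rewrite sum1_card; apply: eq_card => d; rewrite !inE.
    by rewrite big_pred0.
  under eq_bigr => s _ do rewrite big_mkcond.
  under [in RHS]eq_bigr => s _ do rewrite big_mkcond.
  rewrite exchange_big [in RHS]exchange_big; apply: eq_bigr => d _ /=.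
  rewrite -!big_mkcond /= (reindex_onto (fun s => d |: s) (fun s => s :\ d)); last first.
    by move=> s /and3P[_ ds _]; rewrite setD1K.
  apply: eq_bigl => s; rewrite setU11 /=.
  have [ds|ds] := boolP (d \in s).
    rewrite andbF [X in _ && X](_ : _ = false) ?andbF //.
    by apply/negP => /eqP/setP/(_ d); rewrite !inE eqxx ds.
  by rewrite setU1K // eqxx andbT andbC.
have i0d : good (inr @: [set~ i0]).
  by rewrite /good -imset_comp (eq_imset (g := id)) // imset_id.
rewrite (bigD1 _ i0d) /= oddD.
have -> : #|[set v | (v \notin inr @: [set~ i0]) && room (v |: inr @: [set~ i0])]| = 1.
  rewrite -(card_extensions_outer t0 i0); apply: eq_card => v; rewrite !inE /room.
  case: (boolP (v \in _)) => //= vs; rewrite cardsU1 vs card_imset; last by move=> ? ? [].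
  rewrite cardsC1 add1n prednK ?eqxx ?andbT //.
  by apply/card_gt0P; exists i0.
rewrite [odd 1]/= addTb -dvdn2; apply: dvdn_sum => s /andP[gs sout].
have [|] := boolP [exists t, inl t \in s]; last first.
  rewrite negb_exists => /forallP noT; case/eqP: sout.
  apply/setP => -[t|i].
    by rewrite (negPf (noT t)); apply/esym/negbTE/imsetP => -[].
  rewrite mem_imset -?(eqP gs); last by move=> ? ? [].
  apply/idP/imsetP => [is_|[[t|j] js /= ->] //]; first by exists (inr i).
  by have := noT t; rewrite js.
case/existsP => t ts; have [cs|cs] := eqVneq #|s|.+1 #|I|; last first.
  rewrite [X in 2 %| X](_ : _ = 0) //; apply/eqP; rewrite cards_eq0; apply/eqP/setP => v.
  rewrite !inE; apply/negP => /and3P[vs _]; rewrite cardsU1 vs add1n.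
  by rewrite (negPf cs).
have [ds|ds] := boolP (dom s).
  suff -> : #|[set v | (v \notin s) && room (v |: s)]| = 2 by [].
  rewrite -(card_extensions_inner ts cs ds); apply: eq_card => v; rewrite !inE /room.
  by case: (boolP (v \in _)) => //= vs; rewrite cardsU1 vs add1n cs eqxx andbT.
rewrite [X in 2 %| X](_ : _ = 0) //; apply/eqP; rewrite cards_eq0; apply/eqP/setP => v.
rewrite !inE; apply/negP => /and3P[_ dv _]; case/negP: ds.
by apply: dominantS dv; apply: subsetUr.
Qed.

(** Scarf's lemma.  Take a room with all colours and let C consist of the
    indices whose slack elements are absent from it: the slack elements in the
    room carry the colours outside C, hence its points carry those in C. *)
Theorem scarf (t0 : T) : exists (D : {set T}) (C : {set I}),
  (forall t, exists2 i, i \in C & {in D, forall d, r i t <= r i d}) /\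
  c @: D = C.
Proof.
have := odd_colorful_rooms t0 (c t0).
set R := (X in #|X|) => oddR; have /card_gt0P[s] : 0 < #|R| by case: #|R| oddR.
rewrite inE => /and3P[/dominantP doms /eqP cs /eqP cT].
have cinj : {in s &, injective slack_color} by apply/imset_injP; rewrite cT cardsT cs.
exists [set t | inl t \in s], [set i | inr i \notin s]; split=> [t|].
  have [i hi] := doms (inl t); exists i => [|d].
    by rewrite inE; apply/negP => /hi /=; rewrite eqxx.
  by rewrite inE => /hi.
apply/setP => i; rewrite inE; apply/imsetP/idP => [[t]|is_].
  rewrite inE => ts ->; apply/negP => cts.
  by have := cinj _ _ ts cts; move=> /(_ erefl).
have : i \in slack_color @: s by rewrite cT.
case/imsetP => -[t|j] vs /= ij; first by exists t; rewrite ?inE.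
by rewrite ij vs in is_.
Qed.
End Scarf.

(** * Coloured grid points of the simplex *)

(** The points of the d-simplex with coordinates in (1/k)Z, scaled by k. *)
Definition grid (d k : nat) : finType :=
  {a : {ffun 'I_d.+1 -> 'I_k.+1} | \sum_i a i == k}.

Definition gcoord (d k : nat) (a : grid d k) (i : 'I_d.+1) : nat := val a i.

Lemma sum_gcoord (d k : nat) (a : grid d k) : \sum_i gcoord a i = k.
Proof. exact: eqP (valP a). Qed.

Lemma grid_intro (d k : nat) (g : 'I_d.+1 -> nat) : \sum_i g i = k ->
  exists a : grid d k, forall i, gcoord a i = g i.
Proof.
move=> gk; have g_le i : g i < k.+1 by rewrite -gk ltnS (bigD1 i) //= leq_addr.
have ga : \sum_i [ffun i => Ordinal (g_le i)] i == k.
  by rewrite -[k in _ == k]gk; apply/eqP/eq_bigr => i _; rewrite ffunE.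
by exists (exist _ [ffun i => Ordinal (g_le i)] ga) => i; rewrite /gcoord /= ffunE.
Qed.

(** Rank the grid points by each coordinate, breaking ties by enumeration, and
    let D and C come from Scarf's lemma.  The minima over D of the coordinates
    in C must sum to more than k - (d + 1): otherwise a grid point exceeds all
    these minima, against dominance.  As the coordinates of a point sum to k,
    the points of D agree up to d in each coordinate, and their coordinates
    outside C are at most d. *)
Lemma grid_scarf (d k : nat) (c : grid d k -> 'I_d.+1) :
  exists a : grid d k, forall i, d < gcoord a i ->
    exists2 b : grid d k, c b = i &
      forall j, gcoord a j <= gcoord b j + d /\ gcoord b j <= gcoord a j + d.
Proof.
(* The factor #|grid d k| makes the tie-breaking rank a second digit. *)
pose r i (a : grid d k) := gcoord a i * #|grid d k| + enum_rank a.
have rinj i : injective (r i).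
  move=> a b /(congr1 (modn^~ #|grid d k|)).
  by rewrite /r !modnMDl !modn_small //; move/val_inj/enum_rank_inj.
have r_le i a b : r i a <= r i b -> gcoord a i <= gcoord b i.
  move=> ab; rewrite leqNgt; apply/negP => ba.
  suff : r i b < r i a by rewrite ltnNge ab.
  apply: leq_trans (leq_addr _ _); apply: (@leq_trans ((gcoord b i).+1 * #|grid d k|)).
    by rewrite /r mulSn [in leqRHS]addnC ltn_add2l ltn_ord.
  by rewrite leq_mul2r ba orbT.
have [t0 _] : exists a : grid d k, forall i, gcoord a i = (if i == ord0 then k else 0).
  by apply: grid_intro; rewrite -big_mkcond big_pred1_eq.
have [D [C [dom cDC]]] := scarf c rinj t0.
have [x0 x0D] : exists x, x \in D.
  by have [i iC _] := dom t0; move: iC; rewrite -cDC => /imsetP[x xD _]; exists x.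
pose m (i : 'I_d.+1) := if i \in C then gcoord [arg min_(x < x0 in D) gcoord x i] i else 0.
have mle x (i : 'I_d.+1) : x \in D -> m i <= gcoord x i.
  by rewrite /m; case: ifP => // _; case: arg_minnP => // y _ + xD; apply.
have k_lt : k <= \sum_i m i + d.
  rewrite leqNgt; apply/negP => kgt.
  (* One more than the minima, the excess being put on the coordinate 0. *)
  pose g i := m i + (i \in C) + (if i == ord0 then k - \sum_i (m i + (i \in C)) else 0).
  have cC : \sum_i (m i + (i \in C)) <= k.
    have -> : \sum_i (m i + (i \in C)) = \sum_i m i + #|C|.
      rewrite big_split /= -sum1_card; congr addn.
      by rewrite [RHS]big_mkcond; apply: eq_bigr => i _; case: (i \in C).
    rewrite (leq_trans _ kgt) // -addnS.
    by rewrite leq_add2l (leq_trans (max_card _)) ?card_ord.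
  have [t tg] : exists a : grid d k, forall i, gcoord a i = g i.
    by apply: grid_intro; rewrite big_split /= -big_mkcond big_pred1_eq subnKC.
  have [i iC ti] := dom t.
  have : gcoord t i <= m i.
    by rewrite /m iC; case: arg_minnP => // y yD _; apply/r_le/ti.
  by rewrite tg /g iC; lia.
have near x i : x \in D -> gcoord x i <= m i + d.
  move=> xD; have := sum_gcoord x; rewrite (bigD1 i) //=.
  move: k_lt; rewrite (bigD1 i) //=.
  have : \sum_(j < d.+1 | j != i) m j <= \sum_(j < d.+1 | j != i) gcoord x j.
    by apply: leq_sum => j _; apply: mle.
  move: (\sum_(j < d.+1 | _) m j) (\sum_(j < d.+1 | _) gcoord x j) => mC xC.
  by lia.
exists x0 => i di; have iC : i \in C.
  by apply: contraLR di => iC; have := near x0 i x0D; rewrite /m (negPf iC) -leqNgt.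
move: iC; rewrite -cDC => /imsetP[y yD ->]; exists y => // j.
by have := mle y j yD; have := mle x0 j x0D; have := near y j yD; have := near x0 j x0D; lia.
Qed.

(** * Permutations in the support of a matrix *)

(** Hall's marriage theorem, by the induction of Halmos and Vaughan: match a
    tight set within its neighbourhood and the rest outside of it; if no
    proper subset is tight, match one element arbitrarily. *)
Theorem hall (I J : finType) (j0 : J) (N : I -> {set J}) (X : {set I}) :
  (forall S : {set I}, S \subset X -> #|S| <= #|\bigcup_(i in S) N i|) ->
  exists2 m : I -> J, {in X &, injective m} & {in X, forall i, m i \in N i}.
Proof.
have [n] := ubnP #|X|; elim: n => // n IH in N X *; rewrite ltnS => Xn hallX.
have [->|[i0 i0X]] := set_0Vmem X.
  by exists (fun=> j0) => i; rewrite inE.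
have extend (S : {set I}) (Z : {set J}) (m1 : I -> J) :
    S \subset X -> S != set0 -> {in S &, injective m1} ->
    {in S, forall i, m1 i \in N i :&: Z} ->
    (forall S' : {set I}, S' \subset X :\: S ->
       #|S'| <= #|(\bigcup_(i in S') N i) :\: Z|) ->
    exists2 m : I -> J, {in X &, injective m} & {in X, forall i, m i \in N i}.
  move=> SX S0 m1inj m1N hallZ.
  have XS : #|X :\: S| < n.
    by move: S0 (subset_leq_card SX); rewrite -card_gt0 cardsDS //; lia.
  have [|m2 m2inj m2N] := IH (fun i => N i :\: Z) _ XS.
    move=> S' /hallZ; congr (_ <= #|pred_of_set _|); apply/setP => j; rewrite inE.
    apply/andP/bigcupP => [[jZ /bigcupP[i iS' ji]]|[i iS']].
      by exists i; rewrite // inE jZ.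
    by rewrite inE => /andP[jZ ji]; split=> //; apply/bigcupP; exists i.
  have m1Z i : i \in S -> m1 i \in Z by move/m1N; rewrite inE => /andP[].
  have m2Z i : i \in X -> i \notin S -> m2 i \notin Z.
    by move=> iX iS; have := m2N i; rewrite !inE iS iX => /(_ isT)/andP[].
  exists (fun i => if i \in S then m1 i else m2 i) => [i i' iX i'X|i iX].
    case: ifPn => iS; case: ifPn => i'S; first exact: m1inj.
    - by move=> E; have := m2Z i' i'X i'S; rewrite -E m1Z.
    - by move=> E; have := m2Z i iX iS; rewrite E m1Z.
    - by apply: m2inj; rewrite inE ?iS ?i'S.
  case: ifPn => iS; first by have := m1N i iS; rewrite inE => /andP[].
  by have := m2N i; rewrite !inE iS iX => /(_ isT)/andP[].
have [/existsP[S /and4P[SX S0 SnX /eqP tight]]|] :=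
  boolP [exists S : {set I}, [&& S \subset X, S != set0, S != X &
                               #|S| == #|\bigcup_(i in S) N i|]].
  have Sn : #|S| < n.
    by rewrite (leq_trans _ Xn) // proper_card // properEneq SnX.
  have [S' S'S|m1 m1inj m1N] := IH N S Sn; first exact/hallX/(subset_trans S'S).
  apply: (extend S (\bigcup_(i in S) N i) m1) => // [i iS|S' S'XS].
    by rewrite inE m1N //; apply/bigcupP; exists i; rewrite ?m1N.
  have /hallX : S :|: S' \subset X.
    by rewrite subUset SX (subset_trans S'XS) ?subsetDl.
  rewrite bigcup_setU /= cardsU (_ : S :&: S' = set0); last first.
    apply/setP => i; rewrite !inE; apply/negP => /andP[iS /(subsetP S'XS)].
    by rewrite inE iS.
  rewrite cards0 subn0 tight -[X in _ <= X -> _](cardsID (\bigcup_(i in S) N i)).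
  by rewrite setIUl setIid (setUidPl (subsetIr _ _)) setDUl setDv set0U leq_add2l.
rewrite negb_exists => /forallP slack.
have [j jN] : exists j, j \in N i0.
  by apply/card_gt0P; have := hallX [set i0]; rewrite sub1set cards1 big_set1; apply.
apply: (extend [set i0] [set j] (fun=> j)) => [||i i'|i|S' S'X].
- by rewrite sub1set.
- by apply/set0Pn; exists i0; rewrite inE.
- by rewrite !inE => /eqP-> /eqP->.
- by rewrite !inE eqxx andbT => /eqP->.
have [->|S'0] := eqVneq S' set0; first by rewrite cards0.
have S'X' : S' \subset X by rewrite (subset_trans S'X) ?subsetDl.
have S'nX : S' != X.
  by apply: contraTneq S'X => ->; apply/subsetPn; exists i0; rewrite // !inE eqxx.
have := slack S'; rewrite S'X' S'0 S'nX /= => ne.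
have : #|S'| < #|\bigcup_(i in S') N i| by rewrite ltn_neqAle ne hallX.
rewrite (cardsD1 j) => h; rewrite -ltnS (leq_trans h) //.
by rewrite -add1n leq_add2r leq_b1.
Qed.

From mathcomp Require Import all_boot all_order all_algebra all_fingroup.
From mathcomp Require Import all_classical all_reals all_analysis.
From mathcomp Require Import lra.

Import Order.TTheory GRing.Theory Num.Theory.
Import numFieldNormedType.Exports.

Local Open Scope classical_set_scope.
Local Open Scope ring_scope.

(** The part of Birkhoff's theorem that matters here.  The mass of the rows in
    S sits in the columns that meet them in a positive entry, and each column
    holds at most 1, so Hall's condition holds. *)
Lemma positive_entries_perm (R : realType) (n : nat) (g : 'M[R]_n.+1) :
  (forall i j, 0 <= g i j) -> (forall i, \sum_j g i j = 1) ->
  (forall j, \sum_i g i j <= 1) -> exists s : 'S_n.+1, forall i, 0 < g i (s i).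
Proof.
move=> g0 rows cols.
pose N i := [set j | 0 < g i j]%SET.
have [|m minj mN] := @hall _ _ ord0 N [set: 'I_n.+1]%SET.
  move=> S _; rewrite -(ler_nat R); set NS := (\bigcup_(i in S) N i)%SET.
  have -> : #|S|%:R = \sum_(i in S) \sum_(j in NS) g i j :> R.
    rewrite -sum1_card natr_sum; apply: eq_bigr => i iS.
    rewrite -(rows i) (bigID (mem NS)) /= [X in _ + X]big1 ?addr0 // => j jNS.
    apply/eqP; rewrite eq_le g0 andbT leNgt; apply: contra jNS => gij.
    by apply/bigcupP; exists i => //; rewrite inE.
  rewrite exchange_big /= -sum1_card natr_sum; apply: ler_sum => j _.
  apply: le_trans (cols j); rewrite [leRHS](bigID (mem S)) /= lerDl.
  by apply: sumr_ge0.
have {}minj : injective m by move=> i j; apply: minj; rewrite finset.in_setT.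
exists (perm minj) => i; rewrite permE.
by have := mN i (finset.in_setT i); rewrite inE.
Qed.

(** * Closed covers of the simplex *)

Lemma closed_simplex (R : realType) (d : nat) : closed (simplex R d).
Proof.
have -> : simplex R d = [set x | \sum_i x ord0 i = 1] `&`
    \bigcap_(i in setT) [set x | 0 <= x ord0 i].
  by apply/seteqP; split=> x [sx x0]; split=> // i; [move=> _|]; apply: x0.
apply: closedI.
  apply: (@closed_comp _ _ (fun x : 'rV[R]_d.+1 => \sum_i x ord0 i) [set 1]).
    move=> x _; apply: (@continuous_big R 'I_d.+1) => [|i _]; first exact: add_continuous.
    exact: coord_continuous.
  exact: closed_eq.
apply: closed_bigI => i _.
apply: (@closed_comp _ _ (fun x : 'rV[R]_d.+1 => x ord0 i) [set y | 0 <= y]).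
  by move=> x _; apply: coord_continuous.
exact: closed_ge.
Qed.

Lemma compact_simplex (R : realType) (d : nat) : compact (simplex R d).
Proof.
apply: bounded_closed_compact; last exact: closed_simplex.
exists 1; split=> // M M1 x [sx x0] /=.
rewrite [leLHS]/Num.norm /= mx_normrE; apply/bigmax_leP; split => [|[i j] _ /=].
  by rewrite (le_trans _ (ltW M1)).
rewrite (ord1 i) ger0_norm // (le_trans _ (ltW M1)) // -sx (bigD1 j) //= lerDl.
by apply: sumr_ge0.
Qed.

(** The grid lemma rescaled by 1/k, where d / k < e turns its tolerance d
    into e. *)
Lemma simplex_near_colors (R : realType) (d : nat) (c : 'rV[R]_d.+1 -> 'I_d.+1)
    (e : R) :
  0 < e -> exists2 x, simplex R d x &
    forall i, e < x ord0 i -> exists y, [/\ simplex R d y, c y = i & ball x e y].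
Proof.
move=> e0; pose k := (Num.truncn (d%:R / e)).+1.
have k0 : 0 < k%:R :> R by rewrite ltr0n.
have de : d%:R / k%:R < e.
  by rewrite ltr_pdivrMr // mulrC -ltr_pdivrMr // truncnS_gt.
pose p (a : grid d k) : 'rV[R]_d.+1 := \row_i ((gcoord a i)%:R / k%:R).
have pE a i : p a ord0 i = (gcoord a i)%:R / k%:R by rewrite mxE.
have p_simplex a : simplex R d (p a).
  split=> [|i]; last by rewrite pE divr_ge0.
  under eq_bigr => i _ do rewrite pE.
  by rewrite -mulr_suml -natr_sum sum_gcoord divff // gt_eqF.
have [a ha] := grid_scarf (c \o p).
exists (p a) => // i; rewrite pE => eai.
have /ha[b cb ab] : (d < gcoord a i)%N.
  by rewrite -(ltr_nat R) -(ltr_pM2r (x := k%:R^-1)) ?invr_gt0 // (lt_trans de).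
exists (p b); split=> //; split=> // i' j; rewrite ord1 /ball /= !pE.
rewrite -mulrBl normrM (ger0_norm (x := _^-1)) ?invr_ge0 //.
rewrite (le_lt_trans _ de) // ler_pM2r ?invr_gt0 //.
by have [] := ab j; rewrite -!(ler_nat R) !natrD ler_norml => ? ?; apply/andP; split; lra.
Qed.

(** A relative of the KKM theorem, with no condition on how the cover meets the
    faces; Brouwer's fixed point theorem is the case where A i is the set of
    points x with x i <= g x i.  If every x fails, then x is at a positive
    distance from some A i with x i > 0, and by compactness this holds at one
    scale e for all x, against the preceding lemma for a colouring that picks
    a member of the cover. *)
Theorem closed_cover_simplex (R : realType) (d : nat) (A : 'I_d.+1 -> set 'rV[R]_d.+1) :
  (forall i, closed (A i)) -> simplex R d `<=` \bigcup_i A i ->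
  exists2 x, simplex R d x & forall i, 0 < x ord0 i -> A i x.
Proof.
move=> Acl cover.
have /choice[c cA] : forall x, exists i, simplex R d x -> A i x.
  move=> x; have [/cover[i _ Aix]|nx] := pselect (simplex R d x); first by exists i.
  by exists ord0.
pose far (e : R) (x : 'rV[R]_d.+1) := ~ forall i, e < x ord0 i ->
  exists y, [/\ simplex R d y, c y = i & ball x e y].
apply: contrapT => /forall2NP noA.
have farE : \forall e \near 0^'+, simplex R d `<=` far e.
  apply: (proj1 (compact_near_coveringP _) (@compact_simplex R d)) => x xs.
  have [//|/existsNP[i /not_implyP[xi nAx]]] := noA x.
  have : \forall y \near x, (~` A i) y.
    by apply: open_nbhs_nbhs; split=> //; apply: closed_openC.
  move=> /nbhs_ballP[r /= r0 rA].
  near=> x' e => h.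
  have ex' : e < x' ord0 i.
    apply: (@lt_trans _ _ (x ord0 i / 2)); first by near: e; apply: nbhs_right_lt; rewrite divr_gt0.
    near: x'; apply: (cvgr_gt (x ord0 i)) => //; first exact: coord_continuous.
    by rewrite ltr_pdivrMr // mulr2n mulrDr mulr1 ltrDl.
  have [y [ys cy x'y]] := h i ex'.
  apply: (rA y); last by rewrite -cy; apply: cA.
  apply: (@ball_split _ _ x').
    by near: x'; apply: nbhsx_ballx; rewrite divr_gt0.
  apply: le_ball x'y => /=; apply: ltW.
  by near: e; apply: nbhs_right_lt; rewrite divr_gt0.
have [e [e0 fe]] : exists e : R, 0 < e /\ simplex R d `<=` far e.
  apply: (@filter_ex _ (0^'+ : set_system R)).
  by apply: filterI => //; apply: nbhs_right_gt.
have [x xs hx] := simplex_near_colors c e0.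
exact: fe xs hx.
Unshelve. all: by end_near.
Qed.

(** * Almost solutions and their limit *)

Lemma closed_sublevel (R : realType) (T : topologicalType) (K : set T) (h : T -> R) (a : R) :
  closed K -> (forall x, K x -> h @ within K (nbhs x) --> h x) ->
  closed (K `&` [set x | h x <= a]).
Proof.
move=> Kcl hK x xcl; have Kx : K x.
  by rewrite ((closure_id K).1 Kcl); apply: closure_subset xcl => y [].
split=> //=; rewrite leNgt; apply/negP => ax.
have hgt : \forall y \near within K (nbhs x), a < h y by apply: cvgr_gt ax; apply: hK.
have [y [[Ky hy] /(_ Ky) /=]] := xcl _ hgt.
by rewrite ltNge hy.
Qed.

Lemma cvg_entry (R : realType) (m n : nat) (T : Type) (F : set_system T)
    (f : T -> 'M[R]_(m, n)) (M : 'M[R]_(m, n)) i j :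
  Filter F -> f @ F --> M -> f y i j @[y --> F] --> M i j.
Proof.
move=> FF fM; apply: (@cvg_comp _ _ _ f (fun N => N i j) _ _ _ fM).
exact: coord_continuous.
Qed.

(** Because of the factor 1 - e, the total surplus of a row is at least e on the
    simplex, even when x itself is that row of f x, so that rows can be
    normalised continuously.  The surplus in the column j vanishes when x j = 0. *)
Definition surplus (R : realType) (d : nat) (f : 'rV[R]_d.+1 -> 'M[R]_d.+1)
    (e : R) (x : 'rV[R]_d.+1) (i j : 'I_d.+1) : R :=
  Num.max 0 (x ord0 j - (1 - e) * f x i j).

Section AlmostSolution.
Variables (R : realType) (d : nat) (f : 'rV[R]_d.+1 -> 'M[R]_d.+1).
Hypothesis f_stochastic : forall x, simplex R d x -> stochastic R d.+1 (f x).
Hypothesis f_continuous : {within simplex R d, continuous f}.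
Variable e : R.
Hypothesis e01 : 0 < e < 1.
Local Notation sp := (surplus f e).

Let total x i := \sum_j sp x i j.
Let weight x i j := sp x i j / total x i.

Lemma surplus_ge0 x i j : 0 <= sp x i j.
Proof. by rewrite le_max lexx. Qed.

Lemma total_surplus_gt0 x i : simplex R d x -> 0 < total x i.
Proof.
move=> xs; have [sx _] := xs; have [_ sf] := f_stochastic xs.
apply: (@lt_le_trans _ _ (\sum_j (x ord0 j - (1 - e) * f x i j))).
  by rewrite big_split /= sumrN -mulr_sumr sx sf mulr1 subKr; case/andP: e01.
by apply: ler_sum => j _; rewrite le_max lexx orbT.
Qed.

Lemma cvg_surplus x i j : simplex R d x ->
  sp y i j @[y --> within (simplex R d) (nbhs x)] --> sp x i j.
Proof.
move=> xs; have fx : f @ within (simplex R d) (nbhs x) --> f x.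
  exact: (proj1 (subspace_continuousP _ _) f_continuous).
have max0 : continuous (Num.max 0 : R -> R).
  by move=> y; apply: continuous_max; [exact: cvg_cst|exact: cvg_id].
apply: (continuous_cvg _ (max0 _)); apply: cvgB.
  by apply: cvg_within_filter; apply: coord_continuous.
apply: cvgMl_tmp.
exact: cvg_entry.
Qed.

Lemma cvg_weight x i j : simplex R d x ->
  weight y i j @[y --> within (simplex R d) (nbhs x)] --> weight x i j.
Proof.
move=> xs; apply: cvgM; first exact: cvg_surplus.
apply: cvgV; first by rewrite gt_eqF // total_surplus_gt0.
by apply: cvg_big => [|l _]; [exact: add_continuous|exact: cvg_surplus].
Qed.

(** Normalise the rows of the surplus matrix to sum 1 and cover the simplex by
    the closed sets where the j-th column sum is at most 1; these cover, as the
    column sums average 1.  At the point x obtained, the columns with x j > 0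
    have sum at most 1 and the others vanish, so positive surpluses can be
    found along a permutation. *)
Lemma almost_solution : exists x, simplex R d x /\
  exists s : 'S_d.+1, forall i, (1 - e) * f x i (s i) < x ord0 (s i).
Proof.
have weight_ge0 x i j : 0 <= weight x i j.
  by rewrite divr_ge0 ?surplus_ge0 // sumr_ge0 // => l _; apply: surplus_ge0.
have weight_sum x i : simplex R d x -> \sum_j weight x i j = 1.
  by move=> xs; rewrite -mulr_suml divff // gt_eqF // total_surplus_gt0.
pose A j := simplex R d `&` [set x | \sum_i weight x i j <= 1].
have [j||x xs xA] := @closed_cover_simplex R d A.
- apply: closed_sublevel => [|x xs]; first exact: closed_simplex.
  by apply: cvg_big => [|i _]; [exact: add_continuous|exact: cvg_weight].
- move=> x xs; apply: contrapT => noA.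
  have : \sum_(j < d.+1) 1 < \sum_j \sum_i weight x i j.
    apply: ltr_sum; first by apply/hasP; exists ord0; rewrite ?mem_index_enum.
    move=> j _; rewrite ltNge; apply/negP => wj.
    by apply: noA; exists j.
  suff -> : \sum_j \sum_i weight x i j = \sum_(j < d.+1) 1 by rewrite ltxx.
  by rewrite exchange_big; apply: eq_bigr => i _; apply: weight_sum.
exists x; split=> //.
have [|||s ws] := @positive_entries_perm R d (\matrix_(i, j) weight x i j).
- by move=> i j; rewrite mxE.
- by move=> i; under eq_bigr do rewrite mxE; apply: weight_sum.
- move=> j; under eq_bigr do rewrite mxE.
  have [xj|] := ltP 0 (x ord0 j); first by have [] := xA j xj.
  move=> xj; rewrite big1 // => i _; rewrite /weight /surplus.
  have [_ sf] := xs; have [f0 _] := f_stochastic xs.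
  suff -> : Num.max 0 (x ord0 j - (1 - e) * f x i j) = 0 by rewrite mul0r.
  apply/max_idPl; rewrite subr_le0 (le_trans xj) // mulr_ge0 // subr_ge0 ltW //.
  by case/andP: e01.
exists s => i; have := ws i; rewrite mxE ltNge => /negP wi.
rewrite ltNge; apply/negP => xle; apply: wi.
by rewrite /weight /surplus (max_idPl _) ?mul0r // subr_le0.
Qed.
End AlmostSolution.

Unset Implicit Arguments.

Theorem theorem4p7 (R : realType) (d : nat) (f : 'rV[R]_d.+1 -> 'M[R]_d.+1)
    (f_stochastic : forall x, simplex R d x -> stochastic R d.+1 (f x))
    (f_continuous : {within simplex R d, continuous f}) :
  exists (x : 'rV[R]_d.+1) (s : 'S_d.+1),
    simplex R d x /\ forall i : 'I_d.+1, f x i (s i) <= x ord0 (s i).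
Proof.
apply: contrapT => nosol.
pose bad (e : R) (x : 'rV[R]_d.+1) := simplex R d x ->
  forall s : 'S_d.+1, exists i, x ord0 (s i) < (1 - e) * f x i (s i).
(* A failure f x i (s i) > x (s i) persists near x with half of the gap, and
   passing to (1 - e) * f costs at most e since the entries of f are at most 1. *)
have badE : \forall e \near 0^'+, simplex R d `<=` bad e.
  apply: (proj1 (compact_near_coveringP _) (@compact_simplex R d)) => x xs.
  have : forall s : 'S_d.+1, \forall x' \near x & e \near 0^'+,
      simplex R d x' -> exists i, x' ord0 (s i) < (1 - e) * f x' i (s i).
    move=> s.
    have [i xi] : exists i, x ord0 (s i) < f x i (s i).
      apply: contrapT => noi; apply: nosol; exists x, s; split=> // i.
      by rewrite leNgt; apply/negP => xi; apply: noi; exists i.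
    have gap : \forall x' \near within (simplex R d) (nbhs x),
        (f x i (s i) - x ord0 (s i)) / 2 < f x' i (s i) - x' ord0 (s i).
      have fx := proj1 (subspace_continuousP _ _) f_continuous x xs.
      apply: (@cvgr_gt _ _ _ _ _ (f x i (s i) - x ord0 (s i))); last lra.
      apply: cvgB; last by apply: cvg_within_filter; apply: coord_continuous.
      exact: cvg_entry.
    rewrite near_withinE in gap.
    near=> x' e => /= xs'; exists i.
    have gx' : (f x i (s i) - x ord0 (s i)) / 2 < f x' i (s i) - x' ord0 (s i).
      by move: xs'; near: x'.
    have fle1 : f x' i (s i) <= 1.
      have [f0 f1] := f_stochastic _ xs'; rewrite -(f1 i) (bigD1 (s i)) //= lerDl.
      by apply: sumr_ge0.
    have e0 : 0 < e by near: e; apply: nbhs_right_gt.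
    have eg : e < (f x i (s i) - x ord0 (s i)) / 2.
      by near: e; apply: nbhs_right_lt; rewrite divr_gt0 // subr_gt0.
    have : e * f x' i (s i) <= e by rewrite ler_piMr // ltW.
    by rewrite mulrBl mul1r; lra.
  by move=> /filter_forall; apply: filterS => -[x' e] /= h xs' s; apply: h.
have [e [e01 be]] : exists e : R, 0 < e < 1 /\ simplex R d `<=` bad e.
  apply: (@filter_ex _ (0^'+ : set_system R)).
  apply: filterI => //; near=> e; apply/andP; split; near: e.
    exact: nbhs_right_gt.
  exact: nbhs_right_lt.
have [x [xs [s xsol]]] := almost_solution f_stochastic f_continuous e01.
have [i] := be x xs xs s; rewrite ltNge => /negP; apply.
exact/ltW.
Unshelve. all: by end_near.
Qed.
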